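(* Let $s>2$ be a rational number that is not an integer, let $t>1$ be an integer with $p=st$ an integer, and write $q=\lceil s\rceil$. Let $\xi_1,\dots,\xi_q$ be positive integers with $\xi_{q-1}\binom{p-t}{(q-2)t+1}=\xi_q$, $\binom{p-t}{(r-1)t+1}\xi_r=\binom{p-t}{rt}\xi_{r+1}$ for $2\le r\le q-2$, and $(p-t)\xi_1=t\binom{p-t}{t}\xi_2$. Let $\mathcal{C}$ be the array code (over a finite field $\mathbb{F}$, with $t$ rows, entries in $\mathbb{F}^p$ with basis $x_1,\dots,x_p$) whose columns are: (Type $T_1$) for each $t$-subset $A\subseteq\{1,\dots,p\}$, $\xi_1$ columns with cells $x_a$, $a\in A$; (Type $T_r$, $2\le r\le q-1$) for each $(t-1)$-subset $B$ and each $((r-1)t+1)$-subset $C\subseteq\{1,\dots,p\}\setminus B$, $\xi_r$ columns with cells $x_b$ ($b\in B$) and one cell $\sum_{c\in C}x_c$; (Type $T_q$) for each $(t-1)$-subset $B$, $\xi_q$ columns with cells $x_b$ ($b\in B$) and one cell $\sum_{c\notin B}x_c$. Then for every $i\in\{1,\dots,p\}$, the columns of $\mathcal{C}$ that do not have a cell equal to $x_i$ can be partitioned into pairs such that, for each pair, $x_i$ lies in the linear span of the $2t$ cells of the two columns.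
   Context: Columns of an array code are called servers and its entries cells; a cell equal to a single basis vector $x_i$ is called a singleton. *)

(* Defs.v *)
From HB Require Import structures.
From mathcomp Require Import all_boot all_order all_algebra.
Set Implicit Arguments. Unset Strict Implicit. Unset Printing Implicit Defensive.
Import Order.TTheory GRing.Theory Num.Theory.
Local Open Scope ring_scope.

Definition xb (F : fieldType) (p : nat) (i : 'I_p) : 'rV[F]_p := delta_mx 0 i.

(* A column (server) is the list of its t cells. *)
Definition cols_T1 (F : fieldType) (p t : nat) (xi : nat -> nat)
  : seq (seq 'rV[F]_p) :=
  flatten [seq nseq (xi 1%N) [seq xb F a | a <- enum A]
          | A : {set 'I_p} <- enum [set A : {set 'I_p} | #|A| == t]].

Definition cols_Tr (F : fieldType) (p t : nat) (xi : nat -> nat) (r : nat)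
  : seq (seq 'rV[F]_p) :=
  flatten [seq nseq (xi r) (rcons [seq xb F b | b <- enum BC.1]
                                  (\sum_(c in BC.2) xb F c))
          | BC : {set 'I_p} * {set 'I_p} <- enum [set BC : {set 'I_p} * {set 'I_p} |
                        [&& #|BC.1| == t.-1, #|BC.2| == ((r.-1) * t).+1
                          & [disjoint BC.1 & BC.2]]]].

Definition cols_Tq (F : fieldType) (p t : nat) (xi : nat -> nat) (q : nat)
  : seq (seq 'rV[F]_p) :=
  flatten [seq nseq (xi q) (rcons [seq xb F b | b <- enum B]
                                  (\sum_(c in ~: B) xb F c))
          | B : {set 'I_p} <- enum [set B : {set 'I_p} | #|B| == t.-1]].

Definition array_code (F : fieldType) (p t q : nat) (xi : nat -> nat)
  : seq (seq 'rV[F]_p) :=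
  cols_T1 F p t xi
  ++ flatten [seq cols_Tr F p t xi r | r <- iota 2 (q - 2)]
  ++ cols_Tq F p t xi q.

(* Main.v *)
(* Fix [i].  A column of type T_r without the cell [x_i] either avoids [i]
   altogether (r < q) or has [i] in its sum (r > 1).  The columns of type T_r
   avoiding [i] are paired with those of type T_(r+1) whose sum contains [i].
   For r + 1 < q, the indices of the first column should be exactly the other
   indices of the sum of the second one; for r + 1 = q, every index other than [i]
   that does not occur in the first column should be a singleton of the second.
   By symmetry each of these compatibility graphs is biregular, and the equations
   on [xi] say that the two sides, counted with multiplicity, have the same size,
   so Hall's theorem provides a perfect matching. *)
Require Import Defs.
From HB Require Import structures.
From mathcomp Require Import all_boot all_order all_algebra all_field zify.
Set Implicit Arguments. Unset Strict Implicit. Unset Printing Implicit Defensive.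
Import Order.TTheory GRing.Theory Num.Theory.

(** * Hall's theorem and biregular bipartite graphs *)

(** Induction on [#|A|]. If some nonempty proper [S] in [A] is tight (no more neighbours than
    elements), match [S] and [A :\: S] separately. Otherwise every such subset has a spare
    neighbour, so one edge may be fixed freely and its ends removed. [y0] is the value of [f] when
    [A] is empty. *)
Lemma hall_marriage (X Y : finType) (e : X -> Y -> bool) (y0 : Y)
    (A : {set X}) (B : {set Y}) :
  (forall S : {set X}, S \subset A ->
     #|S| <= #|[set y in B | [exists x in S, e x y]]|) ->
  exists2 f : X -> Y, {in A &, injective f}
    & forall x, x \in A -> (f x \in B) && e x (f x).
Proof.
pose N (V : {set Y}) (S : {set X}) := [set y in V | [exists x in S, e x y]].
have [n] := ubnP #|A|; elim: n A B => // n IHn A B ltAn hallA.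
have [-> | [x0 x0A]] := set_0Vmem A.
  by exists (fun=> y0) => [x|x]; rewrite inE.
have [/existsP[S /and4P[S0 SA tight ltSA]]|/existsPn loose] :=
    boolP [exists S : {set X}, [&& S != set0, S \subset A,
             #|N B S| <= #|S| & #|S| < #|A| ]].
  have [||f1 f1inj f1P] := IHn S B.
  - by apply: leq_trans ltSA _.
  - by move=> T TS; apply: hallA; apply: subset_trans SA.
  have [||f2 f2inj f2P] := IHn (A :\: S) (B :\: N B S).
  - have := cardsID S A; rewrite (setIidPr SA) => cA.
    by move: S0; rewrite -card_gt0; lia.
  - move=> T TAS; have TA : T \subset A.
      by apply: subset_trans TAS _; apply: subsetDl.
    have STA : S :|: T \subset A by rewrite subUset SA.
    have dST : [disjoint S & T].
      rewrite disjoint_sym disjoints_subset; apply: subset_trans TAS _.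
      by rewrite setDE subsetIr.
    (* Hall's condition for [S :|: T]: at most [#|S|] of its neighbours lie in [N B S], so [T] keeps
       at least [#|T|] neighbours outside. *)
    have := hallA _ STA; rewrite cardsU.
    have -> : S :&: T = set0 by apply/eqP; rewrite setI_eq0.
    rewrite cards0 subn0.
    have sub : [set y in B | [exists x in S :|: T, e x y]] \subset
        N B S :|: [set y in B :\: N B S | [exists x in T, e x y]].
      apply/subsetP => y; rewrite !inE => /andP[-> /existsP[x /andP[]]].
      rewrite inE => /orP[xS|xT] exy /=.
        by apply/orP; left; apply/existsP; exists x; rewrite xS.
      case: [exists x in S, e x y] => //=.
      by apply/existsP; exists x; rewrite xT.
    move: (subset_leq_card sub); rewrite cardsU => h1 h2.
    by move: tight; lia.
  exists (fun x => if x \in S then f1 x else f2 x) => [x y xA yA /=|x xA].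
    (* Values of [f1] on [S] are neighbours of [S], while [f2] takes its values outside [N B S]. *)
    have f12 u v : u \in S -> v \in A -> v \notin S -> f1 u = f2 v -> False.
      move=> uS vA vS E; have := f2P v; rewrite inE vS vA => /(_ isT).
      rewrite -E !inE => /andP[/andP[/negP h _] _]; apply: h.
      have /andP[-> euf] := f1P u uS.
      by apply/existsP; exists u; rewrite uS.
    case: ifPn => xS; case: ifPn => yS E.
    - exact: f1inj.
    - by case: (f12 x y).
    - by case: (f12 y x).
    - by apply: f2inj; rewrite // inE ?xS ?yS.
  case: ifPn => xS; first exact: f1P.
  by have := f2P x; rewrite !inE xS xA => /(_ isT) /andP[/andP[_ ->]].
have [y1 y1B exy] : exists2 y, y \in B & e x0 y.
  have := hallA [set x0]; rewrite sub1set x0A cards1 => /(_ isT).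
  case/card_gt0P => y; rewrite inE => /andP[yB /existsP[x]].
  by rewrite inE => /andP[/eqP-> ?]; exists y.
have [||f finj fP] := IHn (A :\ x0) (B :\ y1).
- by move: ltAn; rewrite (cardsD1 x0 A) x0A.
- move=> T TA; have [->|T0] := eqVneq T set0; first by rewrite cards0.
  have TA' : T \subset A by apply: subset_trans TA (subsetDl _ _).
  have ltTA : #|T| < #|A|.
    by move: (subset_leq_card TA); rewrite (cardsD1 x0 A) x0A.
  (* No tight set exists, so [T] has at least [#|T| + 1] neighbours and can afford to lose [y1]. *)
  move: (loose T); rewrite T0 TA' ltTA andbT /= -ltnNge.
  rewrite (cardsD1 y1 (N B T)) => h.
  suff -> : [set y in B :\ y1 | [exists x in T, e x y]] = N B T :\ y1.
    by move: h; case: (y1 \in _); lia.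
  by apply/setP => y; rewrite !inE andbA.
have fx0 x : x \in A -> x != x0 -> f x != y1.
  move=> xA xx0; have := fP x; rewrite !inE xA xx0 => /(_ isT).
  by case/andP => /andP[].
exists (fun x => if x == x0 then y1 else f x) => [x y xA yA /=|x xA].
  case: eqVneq => [->|xx0]; case: eqVneq => [->|yx0] // E.
  - by move: (fx0 _ yA yx0); rewrite -E eqxx.
  - by move: (fx0 _ xA xx0); rewrite E eqxx.
  - by apply: finj; rewrite // !inE ?xx0 ?yx0.
case: eqVneq => [->|xx0]; first by rewrite y1B.
by have := fP x; rewrite !inE xA xx0 => /(_ isT) /andP[/andP[_ ->]].
Qed.

Definition blowup (T : Type) n (s : seq T) := flatten (map (nseq n) s).

(** Copies of an element are told apart by a label in ['I_a]; this lets Hall's theorem, stated for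
    sets, handle multiplicities. *)
Lemma enum_setX_blowup (X : finType) (S : {set X}) a :
  perm_eq [seq z.1 | z <- enum (setX S [set: 'I_a])] (blowup a (enum S)).
Proof.
have -> : blowup a (enum S)
    = [seq z.1 | z <- [seq (x, k) | x <- enum S, k <- enum 'I_a]].
  rewrite map_allpairs /blowup; congr flatten; apply: eq_map => x /=.
  by rewrite -[in LHS](size_enum_ord a); elim: (enum 'I_a) => //= _ s ->.
apply: perm_map; apply: uniq_perm => [||[x k]].
- exact: enum_uniq.
- by apply: allpairs_uniq => [||[? ?] [? ?]]; rewrite ?enum_uniq.
rewrite mem_enum !inE andbT; apply/idP/allpairsP => /= [xS|[[y l] /= []]].
  by exists (x, k); rewrite !mem_enum.
by rewrite mem_enum => yS _ [-> _].
Qed.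

Lemma double_count (X Y : finType) (A : {set X}) (B : {set Y}) (e : X -> Y -> bool) :
  \sum_(x in A) #|[set y in B | e x y]| = \sum_(y in B) #|[set x in A | e x y]|.
Proof.
have E (U V : finType) (A' : {set U}) (B' : {set V}) (g : U -> V -> bool) :
    \sum_(x in A') #|[set y in B' | g x y]|
    = \sum_(x in A') \sum_(y in B') g x y.
  apply: eq_bigr => x _; rewrite -sum1_card big_mkcond /= [RHS]big_mkcond /=.
  by apply: eq_bigr => y _; rewrite inE; case: (y \in B') => //; case: (g x y).
by rewrite E exchange_big /= (E _ _ _ _ (fun y x => e x y)).
Qed.

(** With [a] labelled copies of each [x] and [b] of each [y], the graph becomes regular of degree
    [dx * b = dy * a] on both sides. Counting edges gives Hall's condition, and equality of the two
    sizes makes the injection a bijection. *)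
Lemma biregular_matching (X Y : finType) (S : {set X}) (T : {set Y})
    (e : X -> Y -> bool) (a b dx dy : nat) :
    0 < a -> 0 < b -> 0 < dx ->
    (forall x, x \in S -> #|[set y in T | e x y]| = dx) ->
    (forall y, y \in T -> #|[set x in S | e x y]| = dy) ->
    a * #|S| = b * #|T| ->
  exists pairs : seq (X * Y),
    [/\ perm_eq (unzip1 pairs) (blowup a (enum S)),
        perm_eq (unzip2 pairs) (blowup b (enum T))
      & forall z, z \in pairs -> [&& z.1 \in S, z.2 \in T & e z.1 z.2]].
Proof.
move=> a0 b0 dx0 degx degy cST.
have [S0|[x0 x0S]] := set_0Vmem S.
  have T0 : T = set0.
    by apply/eqP; rewrite -cards_eq0; move: cST; rewrite S0 cards0; nia.
  by exists [::]; rewrite S0 T0 /blowup !enum_set0.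
have S1 : 0 < #|S| by apply/card_gt0P; exists x0.
have T1 : 0 < #|T| by nia.
have [y0 y0T] := card_gt0P T1.
have dS : dx * #|S| = dy * #|T|.
  have := double_count S T e; rewrite (eq_bigr (fun=> dx)) // sum_nat_const.
  by rewrite (eq_bigr (fun=> dy)) // sum_nat_const mulnC => ->; rewrite mulnC.
(* Cross-multiply the edge count [dS] with [cST], then cancel [#|S| * #|T|]. *)
have dab : dx * b = dy * a.
  have ST0 : 0 < #|S| * #|T| by rewrite muln_gt0 S1.
  apply/eqP; rewrite -(eqn_pmul2r ST0) mulnACA dS -cST; apply/eqP; nia.
pose A := setX S [set: 'I_a]; pose B := setX T [set: 'I_b].
pose e' (x : X * 'I_a) (y : Y * 'I_b) := e x.1 y.1.
have degA x : x \in A -> #|[set y in B | e' x y]| = dx * b.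
  rewrite !inE andbT => xS; rewrite -(degx _ xS) -[b in RHS]card_ord -cardsT -cardsX.
  by apply: eq_card => y; rewrite !inE !andbT.
have degB y : y \in B -> #|[set x in A | e' x y]| = dy * a.
  rewrite !inE andbT => yT; rewrite -(degy _ yT) -[a in RHS]card_ord -cardsT -cardsX.
  by apply: eq_card => x; rewrite !inE !andbT.
have [S' S'A|f finj fP] := @hall_marriage _ _ e' (y0, Ordinal b0) A B.
  set N := [set y in B | _].
  have pos : 0 < dx * b by rewrite muln_gt0 dx0.
  (* All [#|S'| * (dx * b)] edges leaving [S'] end in [N], and each vertex of [N] receives at most
     [dy * a] of them. *)
  rewrite -(leq_pmul2r pos) [X in _ <= _ * X]dab -!sum_nat_const.
  rewrite [leqLHS](_ : _ = \sum_(x in S') #|[set y in N | e' x y]|); last first.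
    apply: eq_bigr => x xS'; rewrite -(degA x) ?(subsetP S'A) //.
    apply: eq_card => y; rewrite !inE; case exy: (e' x y); rewrite ?andbF //.
    by rewrite !andbT; case: (y.1 \in T) => //=; apply/esym/existsP; exists x; rewrite xS'.
  rewrite double_count; apply: leq_sum => y.
  rewrite inE => /andP[yB _]; rewrite -(degB _ yB); apply: subset_leq_card.
  by apply/subsetP => x; rewrite !inE => /andP[/(subsetP S'A)]; rewrite !inE => -> ->.
exists [seq (x.1, (f x).1) | x <- enum A]; split.
- by rewrite /unzip1 -map_comp; apply: enum_setX_blowup.
- apply: perm_trans (enum_setX_blowup T b).
  rewrite /unzip2 -map_comp (map_comp fst f); apply: perm_map.
  have im : f @: A = B.
    apply/eqP; rewrite eqEcard card_in_imset // !cardsX !cardsT !card_ord.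
    rewrite [leqRHS]mulnC cST mulnC leqnn andbT.
    by apply/subsetP => _ /imsetP[x /fP /andP[xB _] ->].
  apply: uniq_perm => [||y].
  + by rewrite map_inj_in_uniq ?enum_uniq // => x y; rewrite !mem_enum; apply: finj.
  + exact: enum_uniq.
  rewrite mem_enum -/B -im; apply/mapP/imsetP => -[x xA ->]; exists x => //.
    by rewrite -mem_enum.
  by rewrite mem_enum.
move=> _ /mapP[x + ->] /=; rewrite mem_enum => xA.
have /andP[fB ef] := fP x xA; move: xA fB; rewrite !inE !andbT => -> ->; exact: ef.
Qed.

(** Equal columns occur at several positions of the code, so a pairing of column values has to be
    lifted to positions. The permutation of values is realised by a permutation [K] of the selected
    positions, which is then cut into consecutive pairs along [prs]. *)
Lemma pairing_indices (T : eqType) (x0 : T) (C : seq T) (P : pred T) (R : T -> T -> bool)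
    (prs : seq (T * T)) :
    perm_eq (flatten [seq [:: z.1; z.2] | z <- prs]) (filter P C) ->
    all (fun z => R z.1 z.2) prs ->
  exists pairs : seq (nat * nat),
    perm_eq (flatten [seq [:: z.1; z.2] | z <- pairs])
            [seq j <- iota 0 (size C) | P (nth x0 C j)]
    /\ all (fun z => R (nth x0 C z.1) (nth x0 C z.2)) pairs.
Proof.
set J := [seq j <- iota _ _ | _] => pE Rprs.
have CJ : filter P C = [seq nth x0 C j | j <- J].
  by rewrite -{1}(mkseq_nth x0 C) /mkseq filter_map.
have [K pK eK] : exists2 K, perm_eq K J
    & flatten [seq [:: z.1; z.2] | z <- prs] = [seq nth x0 C j | j <- K].
  move: pE; rewrite CJ => /(perm_iotaP x0)[Is pIs ->].
  exists [seq nth 0 J k | k <- Is].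
    have EJ : J = [seq nth 0 J k | k <- iota 0 (size J)].
      by rewrite -[LHS](mkseq_nth 0 J).
    by rewrite [X in perm_eq _ X]EJ; apply: perm_map; rewrite size_map in pIs.
  rewrite -map_comp; apply/eq_in_map => k.
  by rewrite (perm_mem pIs) mem_iota size_map /= => kJ; rewrite (nth_map 0).
suff [pairs Epairs Rpairs] : exists2 pairs : seq (nat * nat),
    flatten [seq [:: z.1; z.2] | z <- pairs] = K
    & all (fun z => R (nth x0 C z.1) (nth x0 C z.2)) pairs.
  by exists pairs; rewrite Epairs.
elim: prs K {pE pK} Rprs eK => [|[u v] prs IH] [|k [|l K]] //=.
  by exists [::].
move=> /andP[Ruv Rprs] [Eu Ev /(IH _ Rprs)[pairs <- Rpairs]].
by exists ((k, l) :: pairs); rewrite //= -Eu -Ev Ruv.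
Qed.

(** * Counting sets and pairs of sets relative to a point *)

(** Double counting of the graph of [f], restricted to the values satisfying [P]. *)
Lemma card_fibers (X V : finType) (S : {set X}) (W : {set V}) (f : X -> V)
    (P : pred V) c :
    (forall x, x \in S -> f x \in W) ->
    (forall v, v \in W -> #|[set x in S | f x == v]| = c) ->
  #|[set x in S | P (f x)]| = #|[set v in W | P v]| * c.
Proof.
move=> fW fib; set S' := [set x in S | _]; set W' := [set v in W | _].
have := double_count S' W' (fun x v => f x == v).
rewrite (eq_bigr (fun=> 1)) => [|x]; last first.
  rewrite inE => /andP[xS Px]; rewrite (_ : [set _ in _ | _] = [set f x]) ?cards1 //.
  apply/setP => v; rewrite !inE eq_sym andbC; case: eqP => // ->.
  by rewrite (fW _ xS).
rewrite sum1_card => ->; rewrite -sum_nat_const; apply: eq_bigr => v.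
rewrite inE => /andP[vW Pv]; rewrite -(fib _ vW); apply: eq_card => x.
by rewrite !inE; case: eqP => [->|]; rewrite ?Pv ?andbT ?andbF.
Qed.

Section Avoiding.
Variables (T : finType) (i : T).
Implicit Types (A B C D E G : {set T}).

Definition avoiding (k : nat) := [set A : {set T} | (#|A| == k) && (i \notin A)].

Definition avoiding_pairs k m :=
  [set BC : {set T} * {set T} |
    [&& BC.1 \in avoiding k, BC.2 \in avoiding m & [disjoint BC.1 & BC.2]]].

(** Here [m] counts the elements of the second set other than [i], so that [BC.2 :\ i] is directly
    comparable with a member of [avoiding m]. *)
Definition hitting_pairs k m :=
  [set BC : {set T} * {set T} |
    [&& BC.1 \in avoiding k, i \in BC.2, #|BC.2| == m.+1 & [disjoint BC.1 & BC.2]]].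

Lemma card_setU1C D k : D \in avoiding k -> #|~: (i |: D)| = #|T|.-1 - k.
Proof.
rewrite inE => /andP[/eqP <- iD]; rewrite cardsCs setCK cardsU1 iD.
by rewrite add1n -subn1 -subnDA.
Qed.

Lemma card_avoiding_subset D k :
  i \notin D -> #|[set A in avoiding k | A \subset D]| = 'C(#|D|, k).
Proof.
move=> iD; rewrite -cards_draws; apply: eq_card => A; rewrite !inE.
case AD: (A \subset D); rewrite ?andbF ?andbT //.
case iA: (i \in A); last by rewrite andbT.
by rewrite (subsetP AD _ iA) in iD.
Qed.

Lemma card_avoiding k : #|avoiding k| = 'C(#|T|.-1, k).
Proof.
rewrite -cardsT (cardsD1 i) in_setT add1n /= -card_avoiding_subset ?setD11 //.
apply: eq_card => A; rewrite !inE; case iA: (i \in A); rewrite ?andbF ?andbT //.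
rewrite (_ : A \subset _) ?andbT //; apply/subsetP => j jA; rewrite !inE andbT.
by apply: contraFneq iA => <-.
Qed.

Lemma setU1C_avoiding D k : D \in avoiding k -> ~: (i |: D) \in avoiding (#|T|.-1 - k).
Proof. by move=> Dk; rewrite inE (card_setU1C Dk) !inE !eqxx. Qed.

Lemma setU1CK D : i \notin D -> ~: (i |: ~: (i |: D)) = D.
Proof.
move=> iD; apply/setP => j; rewrite !inE negb_or negbK.
by case: eqVneq => [->|_] /=; rewrite ?(negPf iD).
Qed.

Lemma setU1C_subset_swap D E : (~: (i |: D) \subset E) = (~: (i |: E) \subset D).
Proof.
by apply/subsetP/subsetP => H j; rewrite !inE negb_or => /andP[ji];
  apply: contraNT => jN; apply: H; rewrite !inE negb_or ji.
Qed.

(* Complementation inside the complement of [i] turns supersets into subsets. *)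
Lemma card_avoiding_supset G g j : G \in avoiding g -> j <= #|T|.-1 ->
  #|[set D in avoiding j | G \subset D]| = 'C(#|T|.-1 - g, #|T|.-1 - j).
Proof.
move=> Gg jT; have iG : i \notin G by move: Gg; rewrite inE => /andP[].
rewrite -(card_setU1C Gg) -card_avoiding_subset; last by rewrite !inE eqxx.
rewrite -(@card_in_imset _ _ (fun D => ~: (i |: D)) [set D in avoiding j | G \subset D]).
  apply: eq_card => E; apply/imsetP/idP => [[D]|].
    rewrite inE => /andP[Dj GD] ->; rewrite inE setU1C_avoiding //=.
    by rewrite setCS setUS.
  rewrite inE => /andP[Ek EG]; exists (~: (i |: E)).
    rewrite inE; have := setU1C_avoiding Ek; rewrite subKn // => ->.
    by rewrite -(setU1CK iG) setCS setUS.
  by rewrite setU1CK //; move: Ek; rewrite inE => /andP[].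
move=> D D'; rewrite !inE => /andP[/andP[_ iD] _] /andP[/andP[_ iD'] _] E.
by rewrite -(setU1CK iD) E setU1CK.
Qed.

Lemma disjoint_setU1C B C :
  [disjoint B & C] && (i \notin C) = (C \subset ~: (i |: B)).
Proof.
rewrite disjoint_sym disjoints_subset setCU subsetI andbC; congr (_ && _).
by rewrite -disjoints_subset disjoint_sym disjoints1.
Qed.

Lemma card_avoiding_pairs k m :
  #|avoiding_pairs k m| = 'C(#|T|.-1, k) * 'C(#|T|.-1 - k, m).
Proof.
rewrite -card_avoiding.
have := @card_fibers _ _ (avoiding_pairs k m) (avoiding k) fst predT
  ('C(#|T|.-1 - k, m)).
rewrite !setIdE !setIT; apply=> [[B C]|B Bk]; first by rewrite inE => /andP[].
rewrite -(card_setU1C Bk) -card_avoiding_subset; last by rewrite !inE eqxx.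
rewrite -[RHS](@card_imset _ _ (pair B)); last by move=> C C' [].
apply: eq_card => -[B' C]; apply/idP/imsetP => [|[C']].
  rewrite !inE /= => /andP[/and3P[_ /andP[Cm iC] dBC] /eqP EB]; subst B'.
  by exists C; rewrite // !inE Cm iC -disjoint_setU1C dBC.
rewrite inE -disjoint_setU1C => /and3P[C'm dBC' iC'] [-> ->].
by rewrite inE inE /= eqxx Bk C'm dBC'.
Qed.

(** Adjoining [i] to the second set is a bijection from [avoiding_pairs k m]. *)
Lemma card_hitting_pairs k m :
  #|hitting_pairs k m| = 'C(#|T|.-1, k) * 'C(#|T|.-1 - k, m).
Proof.
rewrite -card_avoiding_pairs.
rewrite -(@card_in_imset _ _ (fun BC => (BC.1, i |: BC.2)) (avoiding_pairs k m)).
  apply: eq_card => -[B C]; apply/idP/imsetP => [|[[B' C']]].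
    rewrite !inE /= => /and4P[Bk iC]; rewrite (cardsD1 i) iC add1n eqSS => Cm dBC.
    exists (B, C :\ i); last by rewrite /= setD1K.
    rewrite !inE Bk Cm eqxx /=; apply: disjointWr dBC; exact: subsetDl.
  rewrite inE /= => /and3P[Bk]; rewrite inE => /andP[/eqP Cm iC] dBC [-> ->].
  rewrite inE /= Bk setU11 cardsU1 iC Cm eqxx disjoints_subset setCU subsetI.
  by rewrite -!disjoints_subset dBC andbT disjoint_sym disjoints1; move: Bk; rewrite inE => /andP[].
move=> [B C] [B' C']; rewrite !inE /= => /and3P[_ /andP[_ iC] _] /and3P[_ /andP[_ iC'] _].
by case=> -> E; rewrite -(setU1K iC) E setU1K.
Qed.

(** The second set must be [i |: D]; only the first remains free, among the [k]-subsets of the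
    complement of [i |: D]. This is a vertex degree in the first two kinds of compatibility
    graph. *)
Lemma card_hitting_fiber k m D : D \in avoiding m ->
  #|[set BC in hitting_pairs k m | D == BC.2 :\ i]| = 'C(#|T|.-1 - m, k).
Proof.
move=> Dm; have [/eqP cD iD] : #|D| == m /\ i \notin D by move: Dm; rewrite inE => /andP[].
rewrite -(card_setU1C Dm) -card_avoiding_subset; last by rewrite !inE eqxx.
rewrite -[RHS](@card_imset _ _ (fun B => (B, i |: D))); last by move=> C C' [].
apply: eq_card => -[B C]; apply/idP/imsetP => [|[B']].
  rewrite inE inE /= => /andP[/and4P[Bk iC _ dBC] /eqP ->].
  exists B; last by rewrite setD1K.
  by rewrite inE Bk -disjoints_subset /= setD1K.
rewrite inE -disjoints_subset => /andP[Bk dB] [-> ->].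
by rewrite inE inE /= Bk setU11 setU1K // cardsU1 iD cD !eqxx dB.
Qed.

Lemma avoiding_pairs_union k m BC :
  BC \in avoiding_pairs k m -> BC.1 :|: BC.2 \in avoiding (k + m).
Proof.
rewrite !inE => /and3P[/andP[/eqP Bk iB] /andP[/eqP Cm iC]].
rewrite -leq_card_setU => /eqP ->.
by rewrite Bk Cm eqxx (negPf iB).
Qed.

(** Such a pair is a splitting of [D]: any [k]-subset [B] of [D] determines the other part
    [D :\: B]. *)
Lemma card_union_fiber k m D : D \in avoiding (k + m) ->
  #|[set BC in avoiding_pairs k m | BC.1 :|: BC.2 == D]| = 'C(k + m, k).
Proof.
rewrite inE => /andP[/eqP cD iD]; rewrite -cD -card_avoiding_subset //.
rewrite -[RHS](@card_imset _ _ (fun B => (B, D :\: B))); last by move=> C C' [].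
apply: eq_card => -[B C]; apply/idP/imsetP => [|[B']].
  rewrite inE inE /= => /andP[/and3P[Bk _ dBC] /eqP <-].
  exists B; first by rewrite inE Bk subsetUl.
  by rewrite setDUl setDv set0U (setDidPl _) // disjoint_sym.
rewrite inE => /andP[Bk BD] [-> ->].
rewrite !inE /= in Bk *; case/andP: Bk => /eqP Bk iB.
rewrite Bk iB eqxx (negPf iD) andbF /= andbT cardsD (setIidPr BD) cD Bk addKn eqxx.
rewrite -setI_eq0 setIDA setIC setDE -setIA setICr setI0 eqxx /=.
apply/eqP/setP => j; rewrite !inE.
by case jB: (j \in B') => //=; rewrite (subsetP BD).
Qed.

End Avoiding.

(** * Pairings of sequences *)

Definition flatpairs (U : Type) (prs : seq (U * U)) := flatten [seq [:: z.1; z.2] | z <- prs].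

Lemma perm_flatpairs (U : eqType) (prs : seq (U * U)) :
  perm_eq (flatpairs prs) (unzip1 prs ++ unzip2 prs).
Proof.
rewrite /flatpairs; elim: prs => //= -[u v] prs IH /=.
rewrite perm_cons perm_sym perm_catC /= perm_cons perm_catC perm_sym; exact: IH.
Qed.

Lemma biregular_pairing (X Y : finType) (U : eqType) (gx : X -> U) (gy : Y -> U)
    (R : U -> U -> bool) (S : {set X}) (T : {set Y})
    (e : X -> Y -> bool) (a b dx dy : nat) :
    0 < a -> 0 < b -> 0 < dx ->
    (forall x, x \in S -> #|[set y in T | e x y]| = dx) ->
    (forall y, y \in T -> #|[set x in S | e x y]| = dy) ->
    a * #|S| = b * #|T| ->
    (forall x y, x \in S -> y \in T -> e x y -> R (gx x) (gy y)) ->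
  exists2 prs : seq (U * U),
    perm_eq (flatpairs prs)
            (map gx (blowup a (enum S)) ++ map gy (blowup b (enum T)))
    & all (fun z => R z.1 z.2) prs.
Proof.
move=> a0 b0 dx0 degx degy cST eR.
have [ps [p1 p2 pe]] := biregular_matching a0 b0 dx0 degx degy cST.
exists [seq (gx z.1, gy z.2) | z <- ps].
  apply: perm_trans (perm_flatpairs _) _; apply: perm_cat.
    by rewrite /unzip1 -map_comp (map_comp gx fst); apply: perm_map.
  by rewrite /unzip2 -map_comp (map_comp gy snd); apply: perm_map.
by apply/allP => _ /mapP[z /pe/and3P[zS zT ez] ->]; apply: eR.
Qed.

Lemma pairing_flatten (I U : eqType) (R : U -> U -> bool) (W : I -> seq U) (s : seq I) :
    (forall r, r \in s -> exists2 prs : seq (U * U),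
       perm_eq (flatpairs prs) (W r) & all (fun z => R z.1 z.2) prs) ->
  exists2 prs : seq (U * U),
    perm_eq (flatpairs prs) (flatten (map W s)) & all (fun z => R z.1 z.2) prs.
Proof.
elim: s => [|r s IH] H; first by exists [::].
have [|prs p1 a1] := IH; first by move=> k ks; apply: H; rewrite inE ks orbT.
have [|prs' p2 a2] := H r; first exact: mem_head.
exists (prs' ++ prs); last by rewrite all_cat a2.
by rewrite /flatpairs map_cat flatten_cat; apply: perm_cat.
Qed.

(** Regroups the columns from one block per type to one block per pair of consecutive types. The
    first type contributes only an [L] part and the last only an [R] part. *)
Lemma flatten_shift (U : Type) (L R : nat -> seq U) a n :
  L a ++ flatten [seq R r ++ L r | r <- iota a.+1 n] ++ R (a + n).+1
  = flatten [seq L r ++ R r.+1 | r <- iota a n.+1].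
Proof.
elim: n a => [|n IH] a; first by rewrite addn0 /= cats0.
have -> : flatten [seq L r ++ R r.+1 | r <- iota a n.+2] =
    (L a ++ R a.+1) ++ flatten [seq L r ++ R r.+1 | r <- iota a.+1 n.+1] by [].
by rewrite -IH /= addSnnS -!catA.
Qed.

Lemma filter_blowup (X U : Type) (P : pred U) (g : X -> U) n s :
  filter P (map g (blowup n s)) = map g (blowup n (filter (P \o g) s)).
Proof.
rewrite filter_map; congr map; elim: s => //= x s IH.
rewrite /blowup /= filter_cat -/(blowup n s) IH filter_nseq /=.
by case: (P (g x)); rewrite ?mul1n.
Qed.

Lemma map_blowup (X U : Type) (g : X -> U) n s :
  flatten [seq nseq n (g x) | x <- s] = map g (blowup n s).
Proof.
by rewrite /blowup map_flatten -map_comp; congr flatten; apply: eq_map => x /=; rewrite map_nseq.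
Qed.

Lemma perm_blowup (X : eqType) n (s s' : seq X) :
  perm_eq s s' -> perm_eq (blowup n s) (blowup n s').
Proof. by move=> ss'; apply: perm_flatten; apply: perm_map. Qed.

Lemma blowup_cat (X : Type) n (s s' : seq X) : blowup n (s ++ s') = blowup n s ++ blowup n s'.
Proof. by rewrite /blowup map_cat flatten_cat. Qed.

(** * Columns *)

Local Open Scope ring_scope.

Lemma sum_xbE (F : fieldType) p (C : {set 'I_p}) j :
  (\sum_(c in C) xb F c) 0 j = (j \in C)%:R.
Proof.
rewrite summxE; case jC: (j \in C).
  rewrite (bigD1 j) //= mxE !eqxx big1 ?addr0 // => c /andP[_ cj].
  by rewrite mxE eq_sym (negPf cj) andbF.
by rewrite big1 // => c cC; rewrite mxE eqxx /=; case: eqP => // E; rewrite E cC in jC.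
Qed.

Lemma xb_inj (F : fieldType) p : injective (@xb F p).
Proof.
move=> a b /matrixP/(_ 0 a)/eqP; rewrite !mxE !eqxx.
by case: (eqVneq a b) => //= _; rewrite oner_eq0.
Qed.

Lemma mem_map_xb (F : fieldType) p (i : 'I_p) (B : {set 'I_p}) :
  (xb F i \in [seq xb F b | b <- enum B]) = (i \in B).
Proof. by rewrite mem_map ?mem_enum //; apply: xb_inj. Qed.

(** The sum has a nonzero coordinate at each index of [C], a basis vector at only one. Hence a sum
    cell never counts as the singleton [x_i]. *)
Lemma xb_neq_sum (F : fieldType) p (i : 'I_p) (C : {set 'I_p}) :
  (1 < #|C|)%N -> xb F i != \sum_(c in C) xb F c.
Proof.
move=> C2; apply/eqP => E; suff : C \subset [set i].
  by move/subset_leq_card; rewrite cards1 leqNgt C2.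
apply/subsetP => j jC; move/matrixP/(_ 0 j)/eqP: E; rewrite sum_xbE jC !mxE !inE /=.
by case: (j == i) => //=; rewrite eq_sym oner_eq0.
Qed.

(** Subtracting the sum over [D] from the sum over [C] leaves [x_i] plus signed basis vectors
    indexed by the rest of the symmetric difference, all of which lie in [V]. The three recovery
    lemmas are instances. *)
Lemma xb_mem_vspace (F : fieldType) p (V : {vspace 'rV[F]_p}) (i : 'I_p) (C D : {set 'I_p}) :
    \sum_(c in C) xb F c \in V -> \sum_(c in D) xb F c \in V ->
    i \in C -> i \notin D ->
    (forall c, c != i -> (c \in C) != (c \in D) -> xb F c \in V) ->
  xb F i \in V.
Proof.
move=> CV DV iC iD H.
have -> : xb F i = \sum_(c in C) xb F c - \sum_(c in D) xb F c
    - \sum_(c | c != i) ((c \in C)%:R - (c \in D)%:R) *: xb F c.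
  rewrite [in RHS](big_mkcond (mem C)) [in X in _ - X - _](big_mkcond (mem D)) /=.
  rewrite -sumrB (bigD1 i) //= iC (negPf iD) subr0 -addrA -sumrB big1 ?addr0 // => c _.
  by case: (c \in C); case: (c \in D); rewrite !(oppr0, subrr, subr0, sub0r, scale0r, scaleN1r, scale1r).
rewrite memvB // ?memvB // memv_suml // => c ci.
have [->|CD] := eqVneq (c \in C) (c \in D); first by rewrite subrr scale0r mem0v.
by rewrite memvZ // H.
Qed.

Definition col_set (F : fieldType) p (A : {set 'I_p}) : seq 'rV[F]_p :=
  [seq xb F a | a <- enum A].

Definition col_pair (F : fieldType) p (BC : {set 'I_p} * {set 'I_p}) : seq 'rV[F]_p :=
  rcons (col_set F BC.1) (\sum_(c in BC.2) xb F c).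

(** Type [T_q] is presented as a [col_pair] so that the facts on cells and spans of [col_pair] apply
    to it. *)
Definition col_compl (F : fieldType) p (B : {set 'I_p}) : seq 'rV[F]_p :=
  col_pair F (B, ~: B).

Lemma col_pair_mem (F : fieldType) p (i : 'I_p) (BC : {set 'I_p} * {set 'I_p}) :
  (1 < #|BC.2|)%N -> (xb F i \in col_pair F BC) = (i \in BC.1).
Proof.
move=> C2; rewrite /col_pair mem_rcons inE (negPf (xb_neq_sum F i C2)) /=.
exact: mem_map_xb.
Qed.

Lemma filter_cols_T1 (F : fieldType) p t xi (i : 'I_p) :
  perm_eq [seq c <- cols_T1 F p t xi | xb F i \notin c]
    (map (@col_set F p) (blowup (xi 1%N) (enum (avoiding i t)))).
Proof.
rewrite /cols_T1 (map_blowup (@col_set F p)) filter_blowup.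
apply: perm_map; apply: perm_blowup; apply: uniq_perm.
- by rewrite filter_uniq ?enum_uniq.
- exact: enum_uniq.
by move=> A; rewrite mem_filter !mem_enum !inE /= mem_map_xb andbC.
Qed.

(** Since the sum cell has at least two terms, missing [x_i] means [i \notin BC.1]; the two lists
    separate the cases [i \in BC.2] and [i \notin BC.2]. Both have [#|BC.2| = (r.-1 * t).+1], but
    [hitting_pairs] does not count [i] in its parameter. *)
Lemma filter_cols_Tr (F : fieldType) p t xi (i : 'I_p) r :
    (1 < t)%N -> (1 < r)%N ->
  perm_eq [seq c <- cols_Tr F p t xi r | xb F i \notin c]
    (map (@col_pair F p) (blowup (xi r) (enum (hitting_pairs i t.-1 (r.-1 * t))))
     ++ map (@col_pair F p) (blowup (xi r) (enum (avoiding_pairs i t.-1 (r.-1 * t).+1)))).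
Proof.
move=> t1 r1; rewrite /cols_Tr (map_blowup (@col_pair F p)) filter_blowup.
rewrite -map_cat -blowup_cat; apply: perm_map; apply: perm_blowup; apply: uniq_perm.
- by rewrite filter_uniq ?enum_uniq.
- rewrite cat_uniq !enum_uniq andbT /=; apply/hasPn => BC.
  by rewrite !mem_enum !inE => /and3P[_ /andP[_ /negPf->] _]; rewrite andbF.
move=> BC; rewrite mem_filter mem_cat !mem_enum !inE /=.
case: (eqVneq #|BC.2| (r.-1 * t).+1) => [E|]; last by rewrite !andbF.
rewrite col_pair_mem ?E; last by nia.
case: (i \in BC.2); case: (i \in BC.1); case: (_ == t.-1); case: [disjoint _ & _] => //=.
Qed.

Lemma filter_cols_Tq (F : fieldType) p t xi (i : 'I_p) q :
    (t < p)%N -> (0 < t)%N ->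
  perm_eq [seq c <- cols_Tq F p t xi q | xb F i \notin c]
    (map (@col_compl F p) (blowup (xi q) (enum (avoiding i t.-1)))).
Proof.
move=> tp t0; rewrite /cols_Tq (map_blowup (@col_compl F p)) filter_blowup.
apply: perm_map; apply: perm_blowup; apply: uniq_perm.
- by rewrite filter_uniq ?enum_uniq.
- exact: enum_uniq.
move=> B; rewrite mem_filter !mem_enum !inE /= andbC.
(* The complement of [B] has [p - t.-1] elements, which exceeds 1 because [t < p]. *)
case: eqP => //= cB; rewrite /col_compl col_pair_mem //= cardsCs setCK cB card_ord.
by lia.
Qed.

(** * Recovering [x_i] from two compatible columns *)

Lemma col_pair_xb_span (F : fieldType) p (BC : {set 'I_p} * {set 'I_p}) (W : seq 'rV[F]_p) c :
  c \in BC.1 -> {subset col_pair F BC <= W} -> xb F c \in <<W>>%VS.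
Proof.
move=> cB sub; apply: memv_span; apply: sub.
by rewrite mem_rcons inE mem_map_xb cB orbT.
Qed.

Lemma col_pair_sum_span (F : fieldType) p (BC : {set 'I_p} * {set 'I_p}) (W : seq 'rV[F]_p) :
  {subset col_pair F BC <= W} -> \sum_(c in BC.2) xb F c \in <<W>>%VS.
Proof. by move=> sub; apply: memv_span; apply: sub; rewrite mem_rcons mem_head. Qed.

Lemma span_set_pair (F : fieldType) p (i : 'I_p) (A : {set 'I_p}) (BC : {set 'I_p} * {set 'I_p}) :
    i \in BC.2 -> A = BC.2 :\ i ->
  xb F i \in <<col_set F A ++ col_pair F BC>>%VS.
Proof.
move=> iC AE; apply: (@xb_mem_vspace _ _ _ _ BC.2 set0) => //.
- by apply: col_pair_sum_span => c; rewrite mem_cat orbC => ->.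
- by rewrite big_set0 mem0v.
- by rewrite inE.
move=> c ci; rewrite inE eqbF_neg negbK => cC; apply: memv_span.
by rewrite mem_cat mem_map_xb AE !inE ci cC.
Qed.

(** The difference of the two sum cells is [x_i] plus terms whose indices lie in [BC.1], and these
    are singletons of the first column. *)
Lemma span_pair_pair (F : fieldType) p (i : 'I_p) (BC BC' : {set 'I_p} * {set 'I_p}) :
    i \in BC'.2 -> BC.1 :|: BC.2 = BC'.2 :\ i ->
  xb F i \in <<col_pair F BC ++ col_pair F BC'>>%VS.
Proof.
move=> iC E; have iBC : i \notin BC.1 :|: BC.2 by rewrite E !inE eqxx.
have cE c : c != i -> (c \in BC'.2) = (c \in BC.1) || (c \in BC.2).
  by move=> ci; move/setP/(_ c): E; rewrite !inE ci.
apply: (@xb_mem_vspace _ _ _ _ BC'.2 BC.2) => //.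
- by apply: col_pair_sum_span => c; rewrite mem_cat orbC => ->.
- by apply: col_pair_sum_span => c; rewrite mem_cat => ->.
- by apply: contra iBC; rewrite inE orbC => ->.
move=> c ci; rewrite cE // => cB; apply: (@col_pair_xb_span _ _ BC); last first.
  by move=> u; rewrite mem_cat => ->.
by move: cB; case: (c \in BC.1) => //; rewrite eqxx.
Qed.

(** Apart from [i], the sets [~: B] and [BC.2] differ at indices in both [B] and [BC.2], singletons
    of the second column, and at indices in neither, which the inclusion forces into [BC.1]. *)
Lemma span_pair_compl (F : fieldType) p (i : 'I_p) (BC : {set 'I_p} * {set 'I_p}) (B : {set 'I_p}) :
    i \notin BC.2 -> i \notin B -> ~: (i |: (BC.1 :|: BC.2)) \subset B ->
  xb F i \in <<col_pair F BC ++ col_compl F B>>%VS.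
Proof.
move=> iC iB sub.
apply: (@xb_mem_vspace _ _ _ _ (~: B) BC.2) => //.
- by apply: (@col_pair_sum_span _ _ (B, ~: B)) => c; rewrite mem_cat orbC => ->.
- by apply: col_pair_sum_span => c; rewrite mem_cat => ->.
- by rewrite inE.
move=> c ci cBC; have [cB|cB] := boolP (c \in B).
  apply: (@col_pair_xb_span _ _ (B, ~: B)) => // u.
  by rewrite mem_cat orbC => ->.
apply: (@col_pair_xb_span _ _ BC); last by move=> u; rewrite mem_cat => ->.
move: cBC; rewrite inE cB; case cC: (c \in BC.2) => // _.
by apply: contraNT cB => cB; apply: (subsetP sub); rewrite !inE (negPf ci) (negPf cB) cC.
Qed.

(** * Perfect pairings between columns of consecutive types *)

Definition pairable (F : fieldType) p (i : 'I_p) (W : seq (seq 'rV[F]_p)) :=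
  exists2 prs : seq (seq 'rV[F]_p * seq 'rV[F]_p),
    perm_eq (flatpairs prs) W & all (fun z => xb F i \in <<z.1 ++ z.2>>%VS) prs.

Lemma pairing_set_pair (F : fieldType) p (i : 'I_p) k m a b :
    (0 < a)%N -> (0 < b)%N -> (k + m < p)%N ->
    (a * 'C(p.-1, m) = b * ('C(p.-1, k) * 'C(p.-1 - k, m)))%N ->
  pairable i (map (@col_set F p) (blowup a (enum (avoiding i m)))
    ++ map (@col_pair F p) (blowup b (enum (hitting_pairs i k m)))).
Proof.
move=> a0 b0 kmp cE.
(* A set [A] leaves [p.-1 - m] indices from which to choose the [k] singletons of its partner;
   conversely the partner determines [A], whence degree 1. *)
apply: (@biregular_pairing _ _ _ _ _ (fun u v => xb F i \in <<u ++ v>>%VS) _ _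
  (fun A BC => A == BC.2 :\ i) a b 'C(p.-1 - m, k) 1) => //.
- by rewrite bin_gt0; lia.
- by move=> A Am; rewrite card_hitting_fiber // card_ord.
- move=> BC; rewrite !inE => /and4P[_ iC cC _]; rewrite -(cards1 (BC.2 :\ i)).
  apply: eq_card => A; rewrite !inE andbC; case: eqP => // ->.
  by move: cC; rewrite (cardsD1 i) iC add1n eqSS !inE eqxx => ->.
- by rewrite card_avoiding card_hitting_pairs card_ord.
by move=> A BC _; rewrite !inE => /and4P[_ iC _ _] /eqP AE; apply: span_set_pair.
Qed.

Lemma pairing_pair_pair (F : fieldType) p (i : 'I_p) k m a b :
    (0 < a)%N -> (0 < b)%N -> (k + (k + m) < p)%N ->
    (a * ('C(p.-1, k) * 'C(p.-1 - k, m))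
     = b * ('C(p.-1, k) * 'C(p.-1 - k, k + m)))%N ->
  pairable i (map (@col_pair F p) (blowup a (enum (avoiding_pairs i k m)))
    ++ map (@col_pair F p) (blowup b (enum (hitting_pairs i k (k + m))))).
Proof.
move=> a0 b0 kmp cE.
apply: (@biregular_pairing _ _ _ _ _ (fun u v => xb F i \in <<u ++ v>>%VS) _ _
  (fun BC BC' => BC.1 :|: BC.2 == BC'.2 :\ i) a b
  'C(p.-1 - (k + m), k) 'C(k + m, k)) => //.
- by rewrite bin_gt0; lia.
- by move=> BC BCP; rewrite card_hitting_fiber ?avoiding_pairs_union // card_ord.
- move=> BC; rewrite !inE => /and4P[_ iC cC _]; apply: card_union_fiber.
  by move: cC; rewrite (cardsD1 i) iC add1n eqSS !inE eqxx => ->.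
- by rewrite card_avoiding_pairs card_hitting_pairs card_ord.
by move=> BC BC' _; rewrite !inE => /and4P[_ iC _ _] /eqP AE; apply: span_pair_pair.
Qed.

(** The upper bound on [p] says that the [p.-1 - (k + m)] indices missed by the first column, other
    than [i], fit into a set of size [k], so the degrees on that side are positive. *)
Lemma pairing_pair_compl (F : fieldType) p (i : 'I_p) k m a b :
    (0 < a)%N -> (0 < b)%N -> (k + m < p <= (k + (k + m)).+1)%N ->
    (a * 'C(p.-1 - k, m) = b)%N ->
  pairable i (map (@col_pair F p) (blowup a (enum (avoiding_pairs i k m)))
    ++ map (@col_compl F p) (blowup b (enum (avoiding i k)))).
Proof.
move=> a0 b0 /andP[kmp pkm] cE.
have upair BC : BC \in avoiding_pairs i k m ->
    ~: (i |: (BC.1 :|: BC.2)) \in avoiding i (p.-1 - (k + m)).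
  by move/avoiding_pairs_union/setU1C_avoiding; rewrite card_ord.
apply: (@biregular_pairing _ _ _ _ _ (fun u v => xb F i \in <<u ++ v>>%VS) _ _
  (fun (BC : {set 'I_p} * {set 'I_p}) (B : {set 'I_p}) => ~: (i |: (BC.1 :|: BC.2)) \subset B) a b
  'C(p.-1 - (p.-1 - (k + m)), p.-1 - k)
  ('C(p.-1 - (p.-1 - k), p.-1 - (k + m)) * 'C(k + m, k))%N) => //.
- by rewrite bin_gt0; lia.
- move=> BC /upair BCP; rewrite (card_avoiding_supset BCP) card_ord //; lia.
(* By [setU1C_subset_swap], the partners of [B] are the pairs whose union contains [~: (i |: B)]:
   choose the union of size [k + m], then split it in ['C(k + m, k)] ways. *)
- move=> B Bk; have Gk := setU1C_avoiding Bk; rewrite card_ord in Gk.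
  have := card_avoiding_supset (j := k + m) Gk; rewrite card_ord => <-; last by lia.
  rewrite -(card_fibers (S := avoiding_pairs i k m)
    (f := fun BC : {set 'I_p} * {set 'I_p} => BC.1 :|: BC.2)).
  + by apply: eq_card => BC; rewrite !inE setU1C_subset_swap.
  + exact: avoiding_pairs_union.
  exact: card_union_fiber.
- by rewrite card_avoiding_pairs card_avoiding card_ord -cE; lia.
move=> BC B; rewrite !inE => /and3P[_ /andP[_ iC] _] /andP[_ iB] sub.
exact: span_pair_compl.
Qed.

(** * Numerical bounds and assembly of the pairings *)

Lemma ceil_frac_bounds (s : rat) (t p q : nat) :
    2 < s -> s \isn't a Num.int -> (0 < t)%N -> p%:R = s * t%:R ->
    q%:Z = Num.ceil s ->
  (2 < q)%N /\ (q.-1 * t < p < q * t)%N.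
Proof.
move=> s2 sint t0 hp hq.
have t0r : 0 < t%:R :> rat by rewrite ltr0n.
have := ceil_itv s; rewrite -hq => /andP[lo hi].
have hi' : s < q%:R.
  rewrite lt_neqAle -[q%:R]/((q%:Z)%:~R) hi andbT.
  by apply: contraNneq sint => ->; apply: intr_int.
have q2 : (2 < q)%N by rewrite -(ltr_nat rat); apply: lt_trans hi'.
split=> //; rewrite -2!(ltr_nat rat) !natrM hp !ltr_pM2r // hi' andbT.
suff -> : (q.-1)%:R = (q%:Z - 1)%:~R :> rat by [].
by rewrite -[q in RHS]prednK ?(leq_trans _ q2) // -[q.-1.+1]addn1 PoszD addrK.
Qed.

Theorem theorem11 (F : finFieldType) (s : rat) (t p q : nat) (xi : nat -> nat)
  (hs2 : 2 < s) (hsint : s \isn't a Num.int)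
  (ht : (1 < t)%N) (hp : p%:R = s * t%:R) (hq : q%:Z = Num.ceil s)
  (hxi_pos : forall r, (1 <= r <= q)%N -> (0 < xi r)%N)
  (hxq : (xi q.-1 * 'C(p - t, (q - 2) * t + 1) = xi q)%N)
  (hxr : forall r, (2 <= r <= q - 2)%N ->
     ('C(p - t, (r - 1) * t + 1) * xi r = 'C(p - t, r * t) * xi r.+1)%N)
  (hx1 : ((p - t) * xi 1%N = t * 'C(p - t, t) * xi 2%N)%N) :
  let C := array_code F p t q xi in
  forall i : 'I_p,
  exists pairs : seq (nat * nat),
    perm_eq (flatten [seq [:: pr.1; pr.2] | pr <- pairs])
            [seq j <- iota 0 (size C) | xb F i \notin nth [::] C j]
    /\ all (fun pr => xb F i \in <<nth [::] C pr.1 ++ nth [::] C pr.2>>%VS)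
           pairs.
Proof.
move=> C i.
have [q2 /andP[plo phi]] := ceil_frac_bounds hs2 hsint (ltnW ht) hp hq.
have tp : (2 * t < p)%N by nia.
(* [L r] lists the columns of type [T_r] in which [i] does not occur at all, [R r] those in which
   [i] occurs only in the sum. The pairing matches [L r] with [R r.+1]. *)
pose L r := if r == 1%N
  then map (@col_set F p) (blowup (xi r) (enum (avoiding i t)))
  else map (@col_pair F p) (blowup (xi r) (enum (avoiding_pairs i t.-1 (r.-1 * t).+1))).
pose R r := if r == q
  then map (@col_compl F p) (blowup (xi r) (enum (avoiding i t.-1)))
  else map (@col_pair F p) (blowup (xi r) (enum (hitting_pairs i t.-1 (r.-1 * t)))).
have pC : perm_eq [seq c <- C | xb F i \notin c]
    (flatten [seq L r ++ R r.+1 | r <- iota 1 (q - 2).+1]).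
  rewrite -flatten_shift /C /array_code !filter_cat; apply: perm_cat.
    exact: filter_cols_T1.
  apply: perm_cat; last first.
    rewrite (_ : (1 + (q - 2)).+1 = q) /R ?eqxx; last by lia.
    by apply: filter_cols_Tq; lia.
  have : all (fun r => 1 < r < q)%N (iota 2 (q - 2)).
    by apply/allP => r; rewrite mem_iota; lia.
  elim: (iota 2 _) => //= r rs IH /andP[rq /IH{}IH].
  rewrite filter_cat; apply: perm_cat => //; rewrite /L /R.
  by rewrite !ifF; [apply: filter_cols_Tr; lia | lia | lia].
suff [prs pW aW] : pairable i (flatten [seq L r ++ R r.+1 | r <- iota 1 (q - 2).+1]).
  apply: (pairing_indices [::] (P := fun c => xb F i \notin c)
            (R := fun u v => xb F i \in <<u ++ v>>%VS) _ aW).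
  by rewrite (perm_trans pW) // perm_sym.
have pt : (p.-1 - t.-1 = p - t)%N by lia.
apply: (pairing_flatten (R := fun u v => xb F i \in <<u ++ v>>%VS)) => r; rewrite mem_iota => r_range.
have a0 : (0 < xi r)%N by apply: hxi_pos; lia.
have b0 : (0 < xi r.+1)%N by apply: hxi_pos; lia.
have [r1|r1] := eqVneq r 1%N.
  subst r; rewrite /L /R eqxx ifF ?mul1n; last by lia.
  apply: pairing_set_pair => //; first by lia.
  (* This is [t * 'C(p.-1, t) = (p - t) * 'C(p.-1, t.-1)]; multiplying the required equality by [t]
     reduces it to [hx1]. *)
  have := mul_bin_left p.-1 t.-1; rewrite prednK ?pt; last by lia.
  move=> binE; apply/eqP; rewrite -(eqn_pmul2l (ltnW ht)); apply/eqP.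
  by rewrite mulnCA binE mulnA [(xi 1 * _)%N]mulnC hx1; nia.
(* A column of type [T_r] avoiding [i] involves [r * t] indices, exactly the number of indices other
   than [i] in a sum of type [T_(r+1)] containing [i], when [r.+1 < q]. *)
have mE : (r * t = t.-1 + (r.-1 * t).+1)%N by nia.
rewrite /L /R (negPf r1) -[r.+1.-1]/r.
have [rq|rq] := eqVneq r.+1 q.
  (* With [k = t.-1] and [k + m = r * t], the size conditions read [q.-1 * t < p <= q * t]. *)
  apply: pairing_pair_compl => //; first by nia.
  rewrite pt rq -hxq -rq -[r.+1.-1]/r; congr (_ * 'C(_, _))%N.
  by lia.
rewrite mE; apply: pairing_pair_pair => //; first by nia.
(* After cancelling the common factor ['C(p.-1, t.-1)], the balance equation is [hxr]. *)
rewrite -mE pt mulnCA [RHS]mulnCA; congr (_ * _)%N.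
rewrite mulnC [RHS]mulnC -hxr; last by lia.
by congr ('C(_, _) * _)%N; lia.
Qed.
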